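(* Let $\mathsf{C}$ be a Markov category, let $p:\Theta\to X$ be a statistical model in $\mathsf{C}$, and let $s:X\to V$ and $a:X\to W$ be statistics for $p$. If $s$ is sufficient for $p$, the composite morphism $s\circ p$ is complete, and $a$ is ancillary for $p$, then the morphism $(s\otimes a)\circ\mathsf{copy}_X\circ p:\Theta\to V\otimes W$ displays the conditional independence $V\perp W\,||\,\Theta$.
   Context: A Markov category is a symmetric monoidal category $(\mathsf{C},\otimes,I)$ with symmetry $\mathsf{swap}_{X,Y}:X\otimes Y\to Y\otimes X$, in which every object $X$ is equipped with morphisms $\mathsf{copy}_X:X\to X\otimes X$ and $\mathsf{del}_X:X\to I$ forming a commutative comonoid (coassociative, counital, cocommutative), such that: (i) $\mathsf{del}_{X\otimes Y}$ is $\mathsf{del}_X\otimes\mathsf{del}_Y$ followed by $I\otimes I\cong I$; (ii) $\mathsf{copy}_{X\otimes Y}$ is $\mathsf{copy}_X\otimes\mathsf{copy}_Y$ followed by the canonical isomorphism $(X\otimes X)\otimes(Y\otimes Y)\cong(X\otimes Y)\otimes(X\otimes Y)$ swapping the two middle factors; (iii) $\mathsf{del}_Y\circ f=\mathsf{del}_X$ for every $f:X\to Y$. Associators and unitors are suppressed in formulas. Deterministic: $f:X\to Y$ is deterministic if $\mathsf{copy}_Y\circ f=(f\otimes f)\circ\mathsf{copy}_X$. Almost sure equality: for $p:\Theta\to X$ and $f,g:X\to Y$, write $f=_{p\text{-a.s.}}g$ if $(\mathrm{id}_X\otimes f)\circ\mathsf{copy}_X\circ p=(\mathrm{id}_X\otimes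 g)\circ\mathsf{copy}_X\circ p$. A statistical model with values in $X$ is any morphism $p:\Theta\to X$. A statistic for $p:\Theta\to X$ is a deterministic morphism $s:X\to V$. A statistic $s:X\to V$ is sufficient for $p$ if there is $\alpha:V\to X$ such that $(s\otimes\mathrm{id}_X)\circ\mathsf{copy}_X\circ p=(\mathrm{id}_V\otimes\alpha)\circ\mathsf{copy}_V\circ s\circ p$. A morphism $f:X\to Y$ is complete if for all objects $Z$ and all $g,h:Y\to Z$, $g\circ f=h\circ f$ implies $g=_{f\text{-a.s.}}h$. A statistic $a:X\to W$ is ancillary for $p:\Theta\to X$ if $a\circ p=\psi\circ\mathsf{del}_\Theta$ for some $\psi:I\to W$. A morphism $f:A\to X\otimes Y$ displays the conditional independence $X\perp Y\,||\,A$ if there are $g:A\to X$ and $h:A\to Y$ with $f=(g\otimes h)\circ\mathsf{copy}_A$. *)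

(* Defs.v *)
Set Implicit Arguments.
Unset Strict Implicit.

Declare Scope object_scope.
Declare Scope morphism_scope.
Delimit Scope object_scope with object.
Delimit Scope morphism_scope with morphism.

(* [⊗] is used both for objects ([object_scope]) and for morphisms
   ([morphism_scope]). *)
Reserved Notation "g ∘ f" (at level 40, left associativity).
Reserved Notation "A ⊗ B" (at level 35, right associativity).

Record Category := {
  object :> Type;
  hom : object -> object -> Type;
  id : forall A, hom A A;
  comp : forall {A B C}, hom B C -> hom A B -> hom A C
    where "g ∘ f" := (comp g f) : morphism_scope;
  comp_id_l : forall A B (f : hom A B), comp (id B) f = f;
  comp_id_r : forall A B (f : hom A B), comp f (id A) = f;
  comp_assoc : forall A B C D (h : hom C D) (g : hom B C) (f : hom A B),
    comp h (comp g f) = comp (comp h g) f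
}.

Arguments hom {c} A B.
Arguments id {c} A.
Arguments comp {c A B C} g f.
Bind Scope object_scope with object.
Bind Scope morphism_scope with hom.
Notation "g ∘ f" := (comp g f) : morphism_scope.

Open Scope morphism_scope.

Record MonoidalCategory := {
  mon_category :> Category;

  tensor_obj : mon_category -> mon_category -> mon_category
    where "A ⊗ B" := (tensor_obj A B) : object_scope;
  unit_obj : mon_category;
  tensor : forall {A A' B B' : mon_category},
    hom A A' -> hom B B' -> hom (A ⊗ B) (A' ⊗ B')
    where "f ⊗ g" := (tensor f g) : morphism_scope;
  tensor_id : forall A B : mon_category, id A ⊗ id B = id (A ⊗ B);
  tensor_comp : forall (A A' A'' B B' B'' : mon_category)
      (f : hom A A') (f' : hom A' A'') (g : hom B B') (g' : hom B' B''),
    (f' ∘ f) ⊗ (g' ∘ g) = (f' ⊗ g') ∘ (f ⊗ g);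

  assoc : forall A B C, hom ((A ⊗ B) ⊗ C) (A ⊗ (B ⊗ C));
  assoc_inv : forall A B C, hom (A ⊗ (B ⊗ C)) ((A ⊗ B) ⊗ C);
  assoc_inv_l : forall A B C,
    assoc_inv A B C ∘ assoc A B C = id ((A ⊗ B) ⊗ C);
  assoc_inv_r : forall A B C,
    assoc A B C ∘ assoc_inv A B C = id (A ⊗ (B ⊗ C));
  assoc_natural : forall (A A' B B' C C' : mon_category)
      (f : hom A A') (g : hom B B') (h : hom C C'),
    assoc A' B' C' ∘ ((f ⊗ g) ⊗ h) = (f ⊗ (g ⊗ h)) ∘ assoc A B C;

  lunit : forall A, hom (unit_obj ⊗ A) A;
  lunit_inv : forall A, hom A (unit_obj ⊗ A);
  lunit_inv_l : forall A, lunit_inv A ∘ lunit A = id (unit_obj ⊗ A);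
  lunit_inv_r : forall A, lunit A ∘ lunit_inv A = id A;
  lunit_natural : forall (A A' : mon_category) (f : hom A A'),
    lunit A' ∘ (id unit_obj ⊗ f) = f ∘ lunit A;

  runit : forall A, hom (A ⊗ unit_obj) A;
  runit_inv : forall A, hom A (A ⊗ unit_obj);
  runit_inv_l : forall A, runit_inv A ∘ runit A = id (A ⊗ unit_obj);
  runit_inv_r : forall A, runit A ∘ runit_inv A = id A;
  runit_natural : forall (A A' : mon_category) (f : hom A A'),
    runit A' ∘ (f ⊗ id unit_obj) = f ∘ runit A;

  pentagon : forall A B C D,
    assoc A B (C ⊗ D) ∘ assoc (A ⊗ B) C D =
    (id A ⊗ assoc B C D) ∘ assoc A (B ⊗ C) D ∘ (assoc A B C ⊗ id D);
  triangle : forall A B,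
    (id A ⊗ lunit B) ∘ assoc A unit_obj B = runit A ⊗ id B
}.

Arguments tensor_obj {m} A B.
Arguments unit_obj {m}.
Arguments tensor {m A A' B B'} f g.
Arguments assoc {m} A B C.
Arguments assoc_inv {m} A B C.
Arguments lunit {m} A.
Arguments lunit_inv {m} A.
Arguments runit {m} A.
Arguments runit_inv {m} A.
Notation "A ⊗ B" := (tensor_obj A B) : object_scope.
Notation "f ⊗ g" := (tensor f g) : morphism_scope.

(* Only one hexagon is required: the other follows from [swap_swap]. *)
Record SymmetricMonoidalCategory := {
  sym_monoidal :> MonoidalCategory;
  swap : forall A B : sym_monoidal, hom (A ⊗ B) (B ⊗ A);
  swap_natural : forall (A A' B B' : sym_monoidal)
      (f : hom A A') (g : hom B B'),
    swap A' B' ∘ (f ⊗ g) = (g ⊗ f) ∘ swap A B;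
  swap_swap : forall A B, swap B A ∘ swap A B = id (A ⊗ B);
  hexagon : forall A B C,
    assoc B C A ∘ swap A (B ⊗ C) ∘ assoc A B C =
    (id B ⊗ swap A C) ∘ assoc B A C ∘ (swap A B ⊗ id C)
}.

Arguments swap {s} A B.

Definition swap_middle {C : SymmetricMonoidalCategory} (A A' B B' : C) :
    hom ((A ⊗ A') ⊗ (B ⊗ B')) ((A ⊗ B) ⊗ (A' ⊗ B')) :=
  assoc_inv A B (A' ⊗ B')
  ∘ (id A ⊗ (assoc B A' B' ∘ (swap A' B ⊗ id B') ∘ assoc_inv A' B B'))
  ∘ assoc A A' (B ⊗ B').

Record MarkovCategory := {
  markov_symmetric :> SymmetricMonoidalCategory;

  copy : forall X : markov_symmetric, hom X (X ⊗ X);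
  del : forall X : markov_symmetric, hom X unit_obj;

  copy_coassoc : forall X,
    assoc X X X ∘ (copy X ⊗ id X) ∘ copy X = (id X ⊗ copy X) ∘ copy X;
  copy_counit_l : forall X, lunit X ∘ (del X ⊗ id X) ∘ copy X = id X;
  copy_counit_r : forall X, runit X ∘ (id X ⊗ del X) ∘ copy X = id X;
  copy_cocomm : forall X, swap X X ∘ copy X = copy X;

  del_tensor : forall X Y,
    del (X ⊗ Y) = lunit unit_obj ∘ (del X ⊗ del Y);
  copy_tensor : forall X Y,
    copy (X ⊗ Y) = swap_middle X X Y Y ∘ (copy X ⊗ copy Y);
  del_natural : forall (X Y : markov_symmetric) (f : hom X Y),
    del Y ∘ f = del X
}.

Arguments copy {m} X.
Arguments del {m} X.

Section Notions.
Context {C : MarkovCategory}.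
Implicit Types Θ X Y V W A : C.

Definition deterministic {X Y} (f : hom X Y) : Prop :=
  copy Y ∘ f = (f ⊗ f) ∘ copy X.

Definition as_equal {Θ X Y} (p : hom Θ X) (f g : hom X Y) : Prop :=
  (id X ⊗ f) ∘ copy X ∘ p = (id X ⊗ g) ∘ copy X ∘ p.

(* Being a statistic does not depend on the model [p]. *)
Definition statistic {Θ X V} (p : hom Θ X) (s : hom X V) : Prop :=
  deterministic s.

Definition sufficient {Θ X V} (p : hom Θ X) (s : hom X V) : Prop :=
  exists α : hom V X,
    (s ⊗ id X) ∘ copy X ∘ p = (id V ⊗ α) ∘ copy V ∘ s ∘ p.

Definition complete {X Y} (f : hom X Y) : Prop :=
  forall (Z : C) (g h : hom Y Z), g ∘ f = h ∘ f -> as_equal f g h.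

Definition ancillary {Θ X W} (p : hom Θ X) (a : hom X W) : Prop :=
  exists ψ : hom unit_obj W, a ∘ p = ψ ∘ del Θ.

Definition displays_cond_indep {A X Y} (f : hom A (X ⊗ Y)) : Prop :=
  exists (g : hom A X) (h : hom A Y), f = (g ⊗ h) ∘ copy A.

End Notions.

(* Main.v *)
(* Marginalizing the sufficiency equation to its second factor gives
   p = α ∘ s ∘ p.  Hence a ∘ α and the constant morphism ψ ∘ del V agree after
   composition with s ∘ p, so completeness makes them (s ∘ p)-almost surely
   equal.  Thus (s ⊗ a) ∘ copy ∘ p = (id ⊗ (a ∘ α)) ∘ copy ∘ s ∘ p is the joint
   of s ∘ p with a constant, and it does not matter whether the constant is
   paired before or after applying s ∘ p. *)
Require Import Defs.
Local Open Scope morphism_scope.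

(** Naturality of [del] absorbs [f]; the left counit law then removes the deleted copy. *)
Lemma marginal_r (C : MarkovCategory) (X Y Z : C) (f : hom X Y) (g : hom X Z) :
  lunit Z ∘ (del Y ⊗ id Z) ∘ ((f ⊗ g) ∘ copy X) = g.
Proof.
  assert (E : (del Y ⊗ id Z) ∘ (f ⊗ g) = (id unit_obj ⊗ g) ∘ (del X ⊗ id X)).
  { rewrite <- !tensor_comp, del_natural, !comp_id_l, comp_id_r. reflexivity. }
  rewrite comp_assoc, <- (comp_assoc (lunit Z)), E, comp_assoc, lunit_natural.
  rewrite <- !comp_assoc, (comp_assoc (lunit X)), copy_counit_l.
  apply comp_id_r.
Qed.

Lemma runit_inv_natural (C : MonoidalCategory) (X Y : C) (f : hom X Y) :
  (f ⊗ id unit_obj) ∘ runit_inv X = runit_inv Y ∘ f.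
Proof.
  rewrite <- (comp_id_l (f ⊗ id unit_obj)), <- runit_inv_l.
  rewrite <- (comp_assoc (runit_inv Y)), runit_natural.
  rewrite <- !comp_assoc, runit_inv_r, comp_id_r. reflexivity.
Qed.

Lemma copy_del_r (C : MarkovCategory) (X : C) :
  (id X ⊗ del X) ∘ copy X = runit_inv X.
Proof.
  rewrite <- (comp_id_l ((id X ⊗ del X) ∘ copy X)), <- runit_inv_l.
  rewrite <- comp_assoc, (comp_assoc (runit X)), copy_counit_r.
  apply comp_id_r.
Qed.

(** The deleted copy is only an inverse unitor, which slides past [f] by naturality. *)
Lemma pair_constant_r (C : MarkovCategory) (X Y W : C)
    (f : hom X Y) (ψ : hom unit_obj W) :
  (f ⊗ (ψ ∘ del X)) ∘ copy X = (id Y ⊗ ψ) ∘ runit_inv Y ∘ f.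
Proof.
  rewrite <- comp_assoc, <- runit_inv_natural, <- copy_del_r.
  rewrite !comp_assoc, <- !tensor_comp, comp_id_l, !comp_id_r. reflexivity.
Qed.

Theorem theorem15p8 (C : MarkovCategory) (Θ X V W : C)
    (p : hom Θ X) (s : hom X V) (a : hom X W)
    (s_statistic : statistic p s) (a_statistic : statistic p a)
    (s_sufficient : sufficient p s)
    (sp_complete : complete (s ∘ p))
    (a_ancillary : ancillary p a) :
  displays_cond_indep ((s ⊗ a) ∘ copy X ∘ p).
Proof.
  destruct s_sufficient as [α Hα], a_ancillary as [ψ Hψ].
  assert (Hp : α ∘ (s ∘ p) = p).
  { pose proof (f_equal (comp (lunit X ∘ (del V ⊗ id X))) Hα) as E.
    rewrite comp_assoc, marginal_r, comp_id_l in E.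
    rewrite <- (comp_assoc _ s p), comp_assoc, marginal_r in E.
    symmetry. exact E. }
  assert (Has : as_equal (s ∘ p) (a ∘ α) (ψ ∘ del V)).
  { apply sp_complete.
    rewrite <- !comp_assoc, Hp, Hψ, (comp_assoc (del V)), !del_natural.
    reflexivity. }
  exists (s ∘ p), (ψ ∘ del Θ).
  rewrite pair_constant_r.
  transitivity ((id V ⊗ (a ∘ α)) ∘ copy V ∘ (s ∘ p)).
  (* Apply [a] to the [X] factor of the sufficiency equation. *)
  - pose proof (f_equal (comp (id V ⊗ a)) Hα) as E.
    rewrite !comp_assoc, <- !tensor_comp, !comp_id_l, comp_id_r in E.
    rewrite comp_assoc. exact E.
  (* The constant is now paired after [s ∘ p], so [pair_constant_r] is used with [f := id V]. *)
  - unfold as_equal in Has. rewrite Has, pair_constant_r, comp_id_r.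
    reflexivity.
Qed.
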